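(* Let $\alpha,\nu_1,\nu_2,D,\kappa_u,\kappa_{CP},\kappa_{SP}>0$, $0<\hat N\le N$, $w\in[0,1]$, and let $d_{CP},d_{SP}\in\mathbb R$ be the disagreement payoffs. Let $u_{ad},u_s,u_{CP},u_{SP},u_{excess}$ be the functions of $d$ and $p$ given in the context, let $d^*=\operatorname{argmax}_{0\le d\le\hat N\kappa_u}u_{excess}(d)$, and suppose $d^*>0$ and $u_{excess}^*:=u_{excess}(d^* )>0$. Then the optimal solution of $$\max_{d,p}\ (u_{CP}-d_{CP})^{w}(u_{SP}-d_{SP})^{1-w}\quad\text{s.t.}\quad 0\le d\le\hat N\kappa_u,\quad u_{CP}\ge d_{CP},\quad u_{SP}\ge d_{SP}$$ is $(d^*,p^* )$ with $$p^*=\frac{\kappa_u}{d^*}\Big((1-w)(u_{ad}^*-d_{CP})-w(u_s^*-d_{SP})\Big)=\frac{\kappa_u}{d^*}\Big((u_{ad}^*-d_{CP})-w\,u_{excess}^*\Big),$$ where $u_{ad}^*=u_{ad}(d^* )$ and $u_s^*=u_s(d^* )$.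
   Context: A long-sighted content provider (CP) and service provider (SP) bargain over a stable demand $d$ (with number of sponsored bits $b=d/\kappa_u$) and a price $p\in\mathbb R$ per sponsored bit (possibly negative). Their payoffs are $$u_{CP}=u_{ad}(d)-p\frac{d}{\kappa_u},\qquad u_{SP}=p\frac{d}{\kappa_u}+u_s(d),$$ $$u_{ad}(d)=\alpha d\log\left(\frac{\kappa_{CP}}{\kappa_u}\right),\qquad u_s(d)=\nu_1d\log\left(\frac{\kappa_{SP}}{\kappa_u}\right)+\nu_2D\log\left(\kappa_{SP}\frac{N-d/\kappa_u}{D}\right).$$ The number $w$ is the relative bargaining power of the CP. The disagreement payoffs $d_{CP},d_{SP}$ are the payoffs the two players receive if they do not cooperate; they are constants not depending on $d$ or $p$. The aggregate excess profit is $$u_{excess}=u_{CP}-d_{CP}+u_{SP}-d_{SP}=u_{ad}(d)-d_{CP}+u_s(d)-d_{SP},$$ which depends only on $d$. The optimal $(d^*,p^* )$ determines the Nash bargaining solution. Conventions: $\log0=-\infty$, $0^0=1$. *)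

(* Defs.v *)
From mathcomp Require Import all_boot all_order all_algebra.
From mathcomp Require Import all_classical all_reals all_analysis.
From mathcomp Require Import ring.

Set Implicit Arguments.
Unset Strict Implicit.
Unset Printing Implicit Defensive.

Import Order.TTheory GRing.Theory Num.Theory.

Local Open Scope classical_set_scope.
Local Open Scope ring_scope.
Local Open Scope ereal_scope.

Definition argmax {R : realType} {T : Type} (S : set T) (f : T -> \bar R) :
    set T :=
  [set x | S x /\ forall y, S y -> f y <= f x].

Record market (R : realType) := Market {
  alpha : R;
  nu1 : R;
  nu2 : R;
  D : R;
  kappa_u : R;
  kappa_CP : R;
  kappa_SP : R;
  N : R;
  Nhat : R;        (* at most Nhat bits can be sponsored *)
  w : R;           (* relative bargaining power of the content provider *)
  dis_CP : R;      (* disagreement payoffs *)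
  dis_SP : R
}.

Section Payoffs.
Context {R : realType} (M : market R).

Definition u_ad (d : R) : R :=
  (alpha M * d * ln (kappa_CP M / kappa_u M))%R.

(* Extended-real valued: [lne] takes the value -oo at 0, which happens at
   d = N * kappa_u, an admissible demand when Nhat = N. *)
Definition u_s (d : R) : \bar R :=
  (nu1 M * d * ln (kappa_SP M / kappa_u M))%:E
  + (nu2 M * D M)%:E
    * lne (kappa_SP M * ((N M - d / kappa_u M) / D M))%:E.

Definition u_CP (d p : R) : R := (u_ad d - p * (d / kappa_u M))%R.

Definition u_SP (d p : R) : \bar R := (p * (d / kappa_u M))%:E + u_s d.

Definition u_excess (d : R) : \bar R :=
  (u_ad d - dis_CP M)%:E + (u_s d - (dis_SP M)%:E).

Lemma u_excessE (d p : R) :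
  u_excess d = (u_CP d p - dis_CP M)%:E + (u_SP d p - (dis_SP M)%:E).
Proof.
rewrite /u_excess /u_CP /u_SP; case: (u_s d) => [s| |] //=.
by rewrite -!EFinD; congr (_%:E); ring.
Qed.

Definition demands : set R := [set d | (0 <= d <= Nhat M * kappa_u M)%R].

Definition feasible : set (R * R) :=
  [set x | [/\ demands x.1, (dis_CP M <= u_CP x.1 x.2)%R
             & (dis_SP M)%:E <= u_SP x.1 x.2]].

(* On [feasible] both bases are finite and nonnegative; the library's powers
   satisfy 0 `^ 0 = 1. *)
Definition nash_product (x : R * R) : \bar R :=
  (u_CP x.1 x.2 - dis_CP M)%:E `^ w M
  * (u_SP x.1 x.2 - (dis_SP M)%:E) `^ (1 - w M)%R.

End Payoffs.

(* Main.v *)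
(** The product depends on [(d, p)] only through the surpluses [a] and [b] of
    the two players, whose sum is the excess profit of [d], while [p] moves
    surplus freely between them as soon as [d > 0].  By weighted AM-GM, under
    [a + b <= E] the product [a^w b^(1-w)] is maximal exactly at
    [(w E, (1 - w) E)]; so the optimum must have maximal excess, and the excess
    has a unique maximizer because the logarithmic term makes it strictly
    concave. *)

Require Import Defs.
From mathcomp Require Import all_boot all_order all_algebra.
From mathcomp Require Import all_classical all_reals all_analysis.
From mathcomp Require Import ring lra.

Import Order.TTheory GRing.Theory Num.Theory.

Local Open Scope classical_set_scope.
Local Open Scope ring_scope.

(** Strict concavity of the logarithm in tangent form: it is [1 + t < expR t] for nonzero [t], taken
    at [t = ln (x / m)]. The strictness is the source of both uniqueness claims below. *)
Lemma ln_lt_tangent (R : realType) (m x : R) :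
  0 < m -> 0 < x -> x != m -> ln x < ln m + (x / m - 1).
Proof.
move=> m0 x0 xm; have xm0 : 0 < x / m by rewrite divr_gt0.
have lnxm : ln (x / m) != 0.
  by rewrite ln_eq0//; apply: contra xm => /eqP/divr1_eq->.
have := expR_gt1Dx lnxm; rewrite lnK ?posrE// ln_div ?posrE//; lra.
Qed.

Lemma ln_le_tangent (R : realType) (m x : R) :
  0 < m -> 0 < x -> ln x <= ln m + (x / m - 1).
Proof.
move=> m0 x0; have [->|/(ln_lt_tangent _ _ _ m0 x0)/ltW//] := eqVneq x m.
by rewrite divff ?gt_eqF// subrr addr0.
Qed.

(** Adding the tangent bounds at the midpoint [m] cancels the linear corrections, because
    [x / m + y / m = 2]. *)
Lemma ln_midpoint_gt (R : realType) (x y : R) :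
  0 < x -> 0 < y -> x != y -> ln x + ln y < ln ((x + y) / 2) *+ 2.
Proof.
move=> x0 y0 xy; set m := (x + y) / 2.
have m0 : 0 < m by rewrite /m; lra.
have xm : x != m by apply: contra xy => /eqP; rewrite /m => e; apply/eqP; lra.
have ym : y != m by apply: contra xy => /eqP; rewrite /m => e; apply/eqP; lra.
have : x / m + y / m = 2 by rewrite -mulrDl /m; field; lra.
have := ln_lt_tangent _ _ _ m0 x0 xm; have := ln_lt_tangent _ _ _ m0 y0 ym.
lra.
Qed.

Lemma powR_prod_lt (R : realType) (w a b E : R) :
  0 <= w <= 1 -> 0 <= a -> 0 <= b -> a + b <= E -> 0 < E ->
  (a, b) != (w * E, (1 - w) * E) ->
  a `^ w * b `^ (1 - w) < (w * E) `^ w * ((1 - w) * E) `^ (1 - w).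
Proof.
move=> /andP[w0 w1] a0 b0 abE E0 ab.
have [wz|wn0] := eqVneq w 0.
  rewrite wz !powRr0 subr0 !mul1r !powRr1 ?(ltW E0)//.
  rewrite lt_neqAle (_ : b <= E) ?andbT; last lra.
  apply: contra ab => /eqP bE; rewrite wz xpair_eqE mul0r subr0 mul1r.
  by rewrite bE eqxx andbT; apply/eqP; lra.
have [wz|wn1] := eqVneq w 1.
  rewrite wz subrr !powRr0 !mulr1 !mul1r !powRr1 ?(ltW E0)//.
  rewrite lt_neqAle (_ : a <= E) ?andbT; last lra.
  apply: contra ab => /eqP aE; rewrite wz xpair_eqE mul1r subrr mul0r.
  by rewrite aE eqxx; apply/eqP; lra.
have {}w0 : 0 < w by rewrite lt_neqAle eq_sym wn0.
have v0 : 0 < 1 - w by rewrite subr_gt0 lt_neqAle wn1.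
have wE0 : 0 < w * E by rewrite mulr_gt0.
have vE0 : 0 < (1 - w) * E by rewrite mulr_gt0.
have rhs0 : 0 < (w * E) `^ w * ((1 - w) * E) `^ (1 - w).
  by rewrite mulr_gt0// powR_gt0.
have [->|an0] := eqVneq a 0; first by rewrite powR0// mul0r.
have [->|bn0] := eqVneq b 0; first by rewrite (powR0 (lt0r_neq0 v0)) mulr0.
have {}a0 : 0 < a by rewrite lt_neqAle eq_sym an0.
have {}b0 : 0 < b by rewrite lt_neqAle eq_sym bn0.
rewrite /powR !gt_eqF// -!expRD ltr_expR.
have lea := ln_le_tangent _ _ _ wE0 a0; have leb := ln_le_tangent _ _ _ vE0 b0.
(* Tangents are taken at the claimed optimum, so that the weights cancel and the corrections total
   [(a + b) / E - 1]. *)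
have bal : w * (a / (w * E) - 1) + (1 - w) * (b / ((1 - w) * E) - 1) <= 0.
  rewrite (_ : _ + _ = (a + b - E) / E); last by field; rewrite !gt_eqF.
  by rewrite pmulr_lle0 ?invr_gt0// subr_le0.
(* One strict tangent bound suffices: it comes from [a], or else from [b]. *)
have [aE|aE] := eqVneq a (w * E); last first.
  have lta : w * ln a < w * (ln (w * E) + (a / (w * E) - 1)).
    by rewrite ltr_pM2l// ln_lt_tangent.
  have {}leb : (1 - w) * ln b
      <= (1 - w) * (ln ((1 - w) * E) + (b / ((1 - w) * E) - 1)).
    by rewrite ler_pM2l.
  lra.
have bE : b != (1 - w) * E by apply: contra ab => /eqP->; rewrite aE.
have ltb : (1 - w) * ln b
    < (1 - w) * (ln ((1 - w) * E) + (b / ((1 - w) * E) - 1)).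
  by rewrite ltr_pM2l// ln_lt_tangent.
have {}lea : w * ln a <= w * (ln (w * E) + (a / (w * E) - 1)).
  by rewrite ler_pM2l.
lra.
Qed.

Local Open Scope ereal_scope.

Lemma u_s_lt_pinfty (R : realType) (M : market R) (d : R) :
  (0 < nu2 M * D M)%R -> u_s M d < +oo.
Proof.
move=> c0; rewrite /u_s /lne; case: ifP => _; last by rewrite -EFinM -EFinD ltry.
by rewrite gt0_muleNy.
Qed.

(** The argument of the logarithm in [u_s] that depends on the demand. It is affine in [d], hence
    preserves midpoints. *)
Definition quality {R : realType} (M : market R) (d : R) : R :=
  (kappa_SP M * ((N M - d / kappa_u M) / D M))%R.

(** The real value of [u_excess] where [quality] is positive; elsewhere the excess is -oo. *)
Definition excess_fin {R : realType} (M : market R) (d : R) : R :=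
  (u_ad M d - dis_CP M + (nu1 M * d * ln (kappa_SP M / kappa_u M)
    + nu2 M * D M * ln (quality M d) - dis_SP M))%R.

Lemma u_excess_fin_num (R : realType) (M : market R) (d : R) :
  (0 < nu2 M * D M)%R -> -oo < u_excess M d ->
  (0 < quality M d)%R /\ u_excess M d = (excess_fin M d)%:E.
Proof.
move=> c0; rewrite /u_excess /excess_fin /u_s -/(quality M d) /lne.
by case: ifPn => [_|]; [rewrite gt0_muleNy ?lte_fin//= | rewrite -ltNge].
Qed.

Lemma u_excess_pos (R : realType) (M : market R) (d : R) :
  (0 < quality M d)%R -> u_excess M d = (excess_fin M d)%:E.
Proof.
by move=> z0; rewrite /u_excess /u_s -/(quality M d) lne_EFin.
Qed.

Lemma u_excess_argmax_unique (R : realType) (M : market R) (d1 d2 : R) :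
  (0 < nu2 M)%R -> (0 < D M)%R -> (0 < kappa_u M)%R -> (0 < kappa_SP M)%R ->
  -oo < u_excess M d1 ->
  argmax (demands M) (u_excess M) d1 -> argmax (demands M) (u_excess M) d2 ->
  d1 = d2.
Proof.
move=> nu0 D0 ku0 ks0 fin1 [dem1 max1] [dem2 max2].
have c0 : (0 < nu2 M * D M)%R by rewrite mulr_gt0.
have e12 : u_excess M d2 = u_excess M d1.
  by apply/eqP; rewrite eq_le max1// max2.
have fin2 : -oo < u_excess M d2 by rewrite e12.
have [q1 u1] := u_excess_fin_num _ _ _ c0 fin1.
have [q2 u2] := u_excess_fin_num _ _ _ c0 fin2.
(* The midpoint of two distinct maximizers is admissible and would do strictly better: all terms of
   the excess are affine in [d] except the logarithm of [quality]. *)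
apply/eqP; apply/negP => /negP d12; pose m := ((d1 + d2) / 2)%R.
have qm : quality M m = ((quality M d1 + quality M d2) / 2)%R.
  by rewrite /quality /m; field; rewrite !gt_eqF.
have q12 : quality M d1 != quality M d2.
  apply: contra d12 => /eqP; rewrite /quality.
  move=> /(mulfI (lt0r_neq0 ks0))/(mulIf (invr_neq0 (lt0r_neq0 D0)))/addrI.
  by move=> /oppr_inj/(mulIf (invr_neq0 (lt0r_neq0 ku0)))->.
have demm : demands M m.
  by move: dem1 dem2; rewrite /demands /m/= => /andP[? ?] /andP[? ?]; lra.
have qm0 : (0 < quality M m)%R by rewrite qm; lra.
have := max1 _ demm; rewrite u1 (u_excess_pos _ _ _ qm0) lee_fin.
move: e12; rewrite u1 u2 => -[].
have : (nu2 M * D M * (ln (quality M d1) + ln (quality M d2))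
    < nu2 M * D M * (ln (quality M m) *+ 2))%R.
  by rewrite ltr_pM2l// qm ln_midpoint_gt.
rewrite /excess_fin /u_ad /m; lra.
Qed.

Theorem theorem7 (R : realType) (M : market R) (dstar : R)
    (alpha_gt0 : (0 < alpha M)%R) (nu1_gt0 : (0 < nu1 M)%R)
    (nu2_gt0 : (0 < nu2 M)%R) (D_gt0 : (0 < D M)%R)
    (kappa_u_gt0 : (0 < kappa_u M)%R) (kappa_CP_gt0 : (0 < kappa_CP M)%R)
    (kappa_SP_gt0 : (0 < kappa_SP M)%R)
    (Nhat_gt0 : (0 < Nhat M)%R) (Nhat_le_N : (Nhat M <= N M)%R)
    (w_ge0 : (0 <= w M)%R) (w_le1 : (w M <= 1)%R)
    (dstar_argmax : argmax (demands M) (u_excess M) dstar)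
    (dstar_gt0 : (0 < dstar)%R)
    (excess_gt0 : 0 < u_excess M dstar) :
  exists pstar : R,
    [/\ argmax (feasible M) (nash_product M) = [set (dstar, pstar)],
        pstar%:E = (kappa_u M / dstar)%:E
          * ((1 - w M)%:E * (u_ad M dstar - dis_CP M)%:E
             - (w M)%:E * (u_s M dstar - (dis_SP M)%:E))
      & pstar%:E = (kappa_u M / dstar)%:E
          * ((u_ad M dstar - dis_CP M)%:E - (w M)%:E * u_excess M dstar)].
Proof.
have c0 : (0 < nu2 M * D M)%R by rewrite mulr_gt0.
have fin_u : -oo < u_excess M dstar by exact: lt_trans excess_gt0.
have [s us] : exists s : R, u_s M dstar = s%:E.
  have := u_s_lt_pinfty _ M dstar c0; move: fin_u; rewrite /u_excess.
  by case: (u_s M dstar) => [s| |] // _ _; exists s.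
pose E : R := (u_ad M dstar - dis_CP M + (s - dis_SP M))%R.
have uE : u_excess M dstar = E%:E by rewrite /u_excess us.
have E0 : (0 < E)%R by rewrite -lte_fin -uE.
(* The price solving [u_CP M dstar p - dis_CP M = w M * E], which is linear in [p]; the SP is then
   left with the share [(1 - w M) * E]. *)
pose p : R := (kappa_u M / dstar * (u_ad M dstar - dis_CP M - w M * E))%R.
have pE : (p * (dstar / kappa_u M) = u_ad M dstar - dis_CP M - w M * E)%R.
  by rewrite /p; field; rewrite !gt_eqF.
have aE : (u_CP M dstar p - dis_CP M = w M * E)%R.
  by rewrite /u_CP pE; ring.
have bE : u_SP M dstar p - (dis_SP M)%:E = ((1 - w M) * E)%:E.
  by rewrite /u_SP us pE -!EFinD; congr EFin; rewrite /E; ring.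
have feas : feasible M (dstar, p).
  split => /=; first by case: dstar_argmax.
    by rewrite -subr_ge0 aE mulr_ge0// ltW.
  by rewrite -sube_ge0// bE lee_fin mulr_ge0 ?subr_ge0// ltW.
have nashE : nash_product M (dstar, p)
    = ((w M * E) `^ w M * ((1 - w M) * E) `^ (1 - w M))%R%:E.
  by rewrite /nash_product/= aE bE.
have nash_lt x : feasible M x -> x != (dstar, p) ->
    nash_product M x < nash_product M (dstar, p).
  case: x => d q [/= dem aq bq] xn; rewrite nashE /nash_product/=.
  have [b ub] : exists b : R, u_SP M d q - (dis_SP M)%:E = b%:E.
    have := u_s_lt_pinfty _ M d c0; move: bq; rewrite /u_SP.
    by case: (u_s M d) => [t| |] // _ _; eexists; rewrite -!EFinD.
  have b0 : (0 <= b)%R by rewrite -lee_fin -ub sube_ge0.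
  have uab := u_excessE M d q; rewrite ub -EFinD in uab.
  have abE : (u_CP M d q - dis_CP M + b <= E)%R.
    by rewrite -lee_fin -uab -uE; case: dstar_argmax => _; apply.
  rewrite ub !poweR_EFin -EFinM lte_fin powR_prod_lt ?w_ge0 ?subr_ge0//.
  (* If the surpluses are the optimal ones, their sum makes the excess at [d] equal to [E], so [d]
     is a maximizer and equals [dstar]; as [dstar] is positive, the CP's surplus then determines the
     price. *)
  apply: contra xn => /eqP[aeq beq].
  have dd : dstar = d.
    apply: (u_excess_argmax_unique _ M) => //; split => // y dy.
    rewrite uab aeq beq (_ : _ + _ = E)%R; last by ring.
    by rewrite -uE; case: dstar_argmax => _; apply.
  subst d; rewrite xpair_eqE eqxx/=; apply/eqP.
  apply: (mulIf (_ : dstar / kappa_u M != 0)%R).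
    by rewrite gt_eqF// divr_gt0.
  by rewrite pE -aeq /u_CP; ring.
exists p; split.
- apply/seteqP; split => [x [fx xmax]|x ->] /=.
    apply/eqP; apply/negPn/negP => xn.
    by have := nash_lt _ fx xn; rewrite ltNge xmax.
  split => // y fy; have [->//|yn] := eqVneq y (dstar, p).
  exact/ltW/nash_lt.
- rewrite us -EFinB -!EFinM; congr EFin.
  by rewrite /p /E; ring.
- by rewrite uE -!EFinM.
Qed.
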